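(* Let $(E_n)_{n\in\mathbb{N}}$ be a sequence of non-zero finite-dimensional Banach spaces and let $p\in(1,\infty)$. Then the spaces $\left[\bigoplus_{n\in\mathbb{N}}E_n\right]_{\ell_p}$ and $\left[\bigoplus_{n\in\mathbb{N}}E_n\right]_{c_0}$ have no super AD points.
   Context: Banach spaces are over $\mathbb{K}$ ($\mathbb{R}$ or $\mathbb{C}$); $B_X$, $S_X$ denote the closed unit ball and the unit sphere of $X$; $\mathbb{T}=\{\theta\in\mathbb{K}:|\theta|=1\}$. $[\bigoplus_nE_n]_{\ell_p}$ and $[\bigoplus_nE_n]_{c_0}$ denote the $\ell_p$-sum and the $c_0$-sum of the sequence. A point $x\in S_X$ is a super AD point if $\sup_{y\in W}\max_{\theta\in\mathbb{T}}\|x+\theta y\|=2$ for every non-empty relatively weakly open subset $W$ of $B_X$ with $W\cap S_X\neq\emptyset$. *)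

(* Defs.v *)
From HB Require Import structures.
From mathcomp Require Import all_boot all_order all_algebra.
From mathcomp Require Import all_classical all_reals all_analysis.
From mathcomp.real_closed Require Import complex.

Set Implicit Arguments.
Unset Strict Implicit.
Unset Printing Implicit Defensive.

Import Order.TTheory GRing.Theory Num.Theory.
Import numFieldNormedType.Exports.

Local Open Scope classical_set_scope.
Local Open Scope ring_scope.

Variant scalar_kind := RealScalars | ComplexScalars.

Definition scalars (R : realType) (k : scalar_kind) : numFieldType :=
  match k with
  | RealScalars => R
  | ComplexScalars => R[i]
  end.

(* The norm of a normed module over K takes its values in K; [re_part] and
   [of_real] move (nonnegative) norms between K and R. *)
Definition re_part (R : realType) (k : scalar_kind) : scalars R k -> R :=
  match k with
  | RealScalars => id
  | ComplexScalars => @complex.Re R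
  end.

Definition of_real (R : realType) (k : scalar_kind) : R -> scalars R k :=
  match k with
  | RealScalars => id
  | ComplexScalars => real_complex R
  end.

Section scalars_theory.
Variables (R : realType) (k : scalar_kind).
Implicit Types (r s : R) (z : scalars R k).

Lemma of_realK : cancel (@of_real R k) (@re_part R k).
Proof. by case: k. Qed.

Lemma of_real0 : of_real k (0 : R) = 0.
Proof. by case: k. Qed.

Lemma of_realD r s : of_real k (r + s) = of_real k r + of_real k s.
Proof. by case: k => //=; rewrite rmorphD. Qed.

Lemma of_realM r s : of_real k (r * s) = of_real k r * of_real k s.
Proof. by case: k => //=; rewrite rmorphM. Qed.

Lemma ler_of_real r s : (of_real k r <= of_real k s) = (r <= s).
Proof. by case: k => //=; rewrite lecR. Qed.

Lemma re_partK z : 0 <= z -> of_real k (re_part z) = z.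
Proof.
case: k z => //= -[a b]; rewrite lecE /= => /andP[/eqP -> _].
by rewrite complexr0.
Qed.

End scalars_theory.

Definition rnorm (R : realType) (k : scalar_kind)
  (X : normedModType (scalars R k)) (x : X) : R := re_part `|x|.

Section rnorm_theory.
Variables (R : realType) (k : scalar_kind) (X : normedModType (scalars R k)).
Implicit Types x y : X.

Lemma rnormE x : of_real k (rnorm x) = `|x|.
Proof. exact: re_partK. Qed.

Lemma rnorm_ge0 x : 0 <= rnorm x.
Proof. by rewrite -(@ler_of_real R k) of_real0 rnormE. Qed.

Lemma rnorm0 : rnorm (0 : X) = 0.
Proof. by rewrite /rnorm normr0 -(@of_real0 R k) of_realK. Qed.

Lemma rnorm0_eq0 x : rnorm x = 0 -> x = 0.
Proof. by move=> x0; apply/normr0_eq0; rewrite -rnormE x0 of_real0. Qed.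

Lemma ler_rnormD x y : rnorm (x + y) <= rnorm x + rnorm y.
Proof. by rewrite -(@ler_of_real R k) of_realD !rnormE ler_normD. Qed.

Lemma rnormZ (l : scalars R k) x : rnorm (l *: x) = re_part `|l| * rnorm x.
Proof.
apply: (can_inj (@of_realK R k)).
by rewrite of_realM !rnormE re_partK// normrZ.
Qed.

End rnorm_theory.

Definition seq_space (K : numFieldType) (E : nat -> lmodType K) : Type :=
  forall n, E n.
Identity Coercion fun_of_seq_space : seq_space >-> Funclass.

Section seq_space.
Variables (K : numFieldType) (E : nat -> lmodType K).
Implicit Types x y z : seq_space E.

HB.instance Definition _ := gen_eqMixin (seq_space E).
HB.instance Definition _ := gen_choiceMixin (seq_space E).

Let add x y : seq_space E := fun n => x n + y n.
Let opp x : seq_space E := fun n => - x n.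
Let zero : seq_space E := fun=> 0.
Let scale (a : K) x : seq_space E := fun n => a *: x n.

Let addA : associative add.
Proof. by move=> x y z; apply: functional_extensionality_dep => n; apply: addrA. Qed.
Let addC : commutative add.
Proof. by move=> x y; apply: functional_extensionality_dep => n; apply: addrC. Qed.
Let add0 : left_id zero add.
Proof. by move=> x; apply: functional_extensionality_dep => n; apply: add0r. Qed.
Let addN : left_inverse zero opp add.
Proof. by move=> x; apply: functional_extensionality_dep => n; apply: addNr. Qed.

HB.instance Definition _ :=
  GRing.isZmodule.Build (seq_space E) addA addC add0 addN.

Let scaleA a b x : scale a (scale b x) = scale (a * b) x.
Proof. by apply: functional_extensionality_dep => n; apply: scalerA. Qed.
Let scale1 : left_id 1 scale.
Proof. by move=> x; apply: functional_extensionality_dep => n; apply: scale1r. Qed.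
Let scaleDr : right_distributive scale +%R.
Proof. by move=> a x y; apply: functional_extensionality_dep => n; apply: scalerDr. Qed.
Let scaleDl x : {morph scale^~ x : a b / a + b}.
Proof. by move=> a b; apply: functional_extensionality_dep => n; apply: scalerDl. Qed.

HB.instance Definition _ := GRing.Zmodule_isLmodule.Build K (seq_space E)
  scaleA scale1 scaleDr scaleDl.

Lemma seq_spaceD x y n : (x + y) n = x n + y n. Proof. by []. Qed.
Lemma seq_spaceZ a x n : (a *: x) n = a *: x n. Proof. by []. Qed.
Lemma seq_space0 n : (0 : seq_space E) n = 0. Proof. by []. Qed.

End seq_space.

Section lp_sum.
Variables (R : realType) (k : scalar_kind).
Local Notation K := (scalars R k).
Variable E : nat -> normedModType K.
Local Notation S := (seq_space (fun n => E n : lmodType K)).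

Section lp_norm.
Variable p : R.

(* +oo exactly when the series diverges *)
Definition lp_enorm (x : S) : \bar R :=
  ((\sum_(n <oo) (rnorm (x n) `^ p)%:E) `^ p^-1)%E.

Definition lp_pred : {pred S} := fun x => `[< (lp_enorm x < +oo)%E >].

Hypothesis p1 : 1 <= p.

Let p0 : 0 < p. Proof. exact: lt_le_trans p1. Qed.

Local Open Scope ereal_scope.

Lemma lp_enormE (x : S) :
  lp_enorm x = 'N[counting]_p%:E[EFin \o (fun n => rnorm (x n))].
Proof.
rewrite Lnorm_counting// /lp_enorm; congr (_ `^ _).
apply: eq_eseriesr => n _ /=.
by rewrite ger0_norm ?rnorm_ge0.
Qed.

Lemma lp_enorm_ge0 (x : S) : 0 <= lp_enorm x.
Proof. exact: poweR_ge0. Qed.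

Lemma lp_enormD (x y : S) : lp_enorm (x + y)%R <= lp_enorm x + lp_enorm y.
Proof.
rewrite [in leRHS]lp_enormE [in leRHS]lp_enormE.
apply: le_trans (minkowski_EFin _ _ _ _) => //.
rewrite Lnorm_counting// /lp_enorm.
apply: gt0_ler_poweR; first by rewrite invr_ge0 ltW.
- by rewrite in_itv/= leey andbT; apply: nneseries_ge0 => n _ _; rewrite lee_fin powR_ge0.
- by rewrite in_itv/= leey andbT; apply: nneseries_ge0 => n _ _; rewrite lee_fin powR_ge0.
apply: lee_nneseries => [n _|n _ /=]; first by rewrite lee_fin powR_ge0.
rewrite lee_fin; apply: ge0_ler_powR; rewrite ?nnegrE ?rnorm_ge0 ?(ltW p0)//.
rewrite [leRHS]ger0_norm ?addr_ge0 ?rnorm_ge0//.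
exact: ler_rnormD.
Qed.

Lemma lp_enormZ (a : K) (x : S) :
  lp_enorm (a *: x)%R = (re_part `|a|%R)%:E * lp_enorm x.
Proof.
have a0 : (0 <= re_part `|a|)%R by rewrite -(@ler_of_real R k) of_real0 re_partK.
rewrite /lp_enorm.
under eq_eseriesr do rewrite seq_spaceZ rnormZ powRM ?rnorm_ge0// EFinM.
rewrite nneseriesZl ?lee_fin ?powR_ge0//; last first.
  by move=> n _; rewrite lee_fin powR_ge0.
rewrite poweRM ?lee_fin ?powR_ge0//; last first.
  by rewrite nneseries_ge0// => n _ _; rewrite lee_fin powR_ge0.
by rewrite poweR_EFin -powRrM divff ?gt_eqF// powRr1.
Qed.

Lemma lp_enorm0 : lp_enorm 0%R = 0.
Proof.
rewrite /lp_enorm eseries0 ?poweR0r ?invr_neq0 ?gt_eqF// => n _ _.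
by rewrite seq_space0 rnorm0 powR0 ?gt_eqF.
Qed.

Lemma lp_enorm_eq0 (x : S) : lp_enorm x = 0 -> x = 0%R.
Proof.
move=> /poweR_eq0_eq0 H.
have ge n : (0 <= (rnorm (x n) `^ p)%:E)%E by rewrite lee_fin powR_ge0.
have {}H : \sum_(n <oo) (rnorm (x n) `^ p)%:E = 0.
  by apply: H; rewrite nneseries_ge0.
apply: functional_extensionality_dep => n; apply: rnorm0_eq0.
have /eqP : (rnorm (x n) `^ p)%:E = 0.
  apply/eqP; rewrite eq_le ge andbT -H.
  rewrite (@nneseriesD1 _ _ n)//.
  by rewrite leeDl// nneseries_ge0.
by rewrite eqe powR_eq0 => /andP[/eqP].
Qed.

Local Close Scope ereal_scope.

Lemma lp_submod_closed : submod_closed lp_pred.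
Proof.
split; first by apply/asboolP; rewrite lp_enorm0.
move=> a x y /asboolP xoo /asboolP yoo; apply/asboolP.
rewrite (le_lt_trans (lp_enormD _ _))// lte_add_pinfty// lp_enormZ.
by rewrite lte_mul_pinfty// ?lee_fin -?(@ler_of_real R k) ?of_real0 ?re_partK.
Qed.

End lp_norm.

Record lp_sum (p : R) (p1 : 1 <= p) :=
  LpSum { lp_seq :> S ; _ : lp_seq \in lp_pred p }.

Section lp_sum_structure.
Variables (p : R) (p1 : 1 <= p).
Local Notation L := (lp_sum p1).
Implicit Types x y : L.

HB.instance Definition _ := [isSub for @lp_seq p p1].
HB.instance Definition _ := [Choice of L by <:].
HB.instance Definition _ :=
  GRing.isSubmodClosed.Build K S (lp_pred p) (lp_submod_closed p1).
HB.instance Definition _ := [SubChoice_isSubLmodule of L by <:].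

Definition lp_norm x : R := fine (lp_enorm p x).

Lemma lp_normE x : (lp_norm x)%:E = lp_enorm p x.
Proof.
rewrite /lp_norm fineK// ge0_fin_numE ?lp_enorm_ge0//.
by apply/asboolP; exact: (valP x).
Qed.

Let normK x : K := of_real k (lp_norm x).

Let normKD x y : normK (x + y) <= normK x + normK y.
Proof.
rewrite -of_realD ler_of_real -lee_fin EFinD !lp_normE.
exact: lp_enormD.
Qed.

Let normKZ (a : K) x : normK (a *: x) = `|a| * normK x.
Proof.
rewrite -[`|a|]re_partK// -of_realM; congr of_real; apply: EFin_inj.
rewrite EFinM !lp_normE; exact: lp_enormZ.
Qed.

Let normK0 x : normK x = 0 -> x = 0.
Proof.
move=> x0; apply: val_inj; apply: (@lp_enorm_eq0 p).
by rewrite -lp_normE -[lp_norm x](@of_realK R k) [of_real _ _]x0 -(@of_real0 R k)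
  of_realK.
Qed.

HB.instance Definition _ := @Lmodule_isNormed.Build K L normK normKD normKZ normK0.

Lemma rnorm_lpE x : rnorm x = lp_norm x.
Proof. exact: of_realK. Qed.

End lp_sum_structure.
End lp_sum.

Section c0_sum.
Variables (R : realType) (k : scalar_kind).
Local Notation K := (scalars R k).
Variable E : nat -> normedModType K.
Local Notation S := (seq_space (fun n => E n : lmodType K)).

Definition c0_pred : {pred S} :=
  fun x => `[< (fun n => rnorm (x n)) @ \oo --> (0 : R) >].

Lemma c0_submod_closed : submod_closed c0_pred.
Proof.
split.
  apply/asboolP; under eq_fun do rewrite seq_space0 rnorm0.
  exact: cvg_cst.
move=> a x y /asboolP x0 /asboolP y0; apply/asboolP.
have H : (fun n => re_part `|a| * rnorm (x n) + rnorm (y n)) @ \oo --> (0 : R).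
  rewrite -[0 : R]addr0 -[X in X + _](mulr0 (re_part `|a|)).
  by apply: cvgD => //; apply: cvgMr.
apply: (squeeze_cvgr _ (cvg_cst (0 : R)) H).
apply: nearW => n; rewrite rnorm_ge0/= seq_spaceD seq_spaceZ -rnormZ.
exact: ler_rnormD.
Qed.

Record c0_sum := C0Sum { c0_seq :> S ; _ : c0_seq \in c0_pred }.

Implicit Types x y : c0_sum.

HB.instance Definition _ := [isSub for c0_seq].
HB.instance Definition _ := [Choice of c0_sum by <:].
HB.instance Definition _ :=
  GRing.isSubmodClosed.Build K S c0_pred c0_submod_closed.
HB.instance Definition _ := [SubChoice_isSubLmodule of c0_sum by <:].

Definition c0_norm x : R := sup (range (fun n => rnorm (x n))).

Lemma c0_has_sup x : has_sup (range (fun n => rnorm (x n))).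
Proof.
split; first by exists (rnorm (x 0%N)), 0%N.
have /asboolP x0 := valP x.
have /cvg_seq_bounded [M [_ /(_ (M + 1))]] : cvgn (fun n => rnorm (x n)).
  by apply/cvg_ex; exists 0.
rewrite ltrDl ltr01 => /(_ isT) H.
exists (M + 1) => _ [n _ <-].
by apply: le_trans (H n I); rewrite /= ler_norm.
Qed.

Lemma rnorm_le_c0 x n : rnorm (x n) <= c0_norm x.
Proof. by apply: ub_le_sup; [exact: (c0_has_sup x).2 | exists n]. Qed.

Lemma c0_norm_le x M : (forall n, rnorm (x n) <= M) -> c0_norm x <= M.
Proof.
move=> H; apply: ge_sup; first exact: (c0_has_sup x).1.
by move=> _ [n _ <-].
Qed.

Let normK x : K := of_real k (c0_norm x).

Let normKD x y : normK (x + y) <= normK x + normK y.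
Proof.
rewrite -of_realD ler_of_real; apply: c0_norm_le => n.
rewrite (le_trans (ler_rnormD (x n) (y n)))//.
by rewrite lerD ?rnorm_le_c0.
Qed.

Let c0_normZ_le (a : K) x : c0_norm (a *: x) <= re_part `|a| * c0_norm x.
Proof.
apply: c0_norm_le => n; rewrite (rnormZ a (x n)) ler_wpM2l ?rnorm_le_c0//.
by rewrite -(@ler_of_real R k) of_real0 re_partK.
Qed.

Let normKZ (a : K) x : normK (a *: x) = `|a| * normK x.
Proof.
rewrite -[`|a|]re_partK// -of_realM; congr of_real.
have a0 : 0 <= re_part `|a| by rewrite -(@ler_of_real R k) of_real0 re_partK.
apply/eqP; rewrite eq_le c0_normZ_le/=.
have [->|aN0] := eqVneq a 0.
  rewrite normr0 -(@of_real0 R k) of_realK mul0r.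
  apply: le_trans (rnorm_le_c0 _ 0%N); exact: rnorm_ge0.
have /= := c0_normZ_le a^-1 (a *: x).
rewrite scalerA mulVf// scale1r => /(ler_wpM2l a0) /le_trans; apply.
rewrite mulrA -[X in X * _](@of_realK R k) of_realM !re_partK// -normrM divff//.
have -> : re_part (`|1| : K) = 1 :> R.
  by rewrite normr1; case: (k).
by rewrite mul1r.
Qed.

Let normK0 x : normK x = 0 -> x = 0.
Proof.
move=> x0; apply: val_inj; apply: functional_extensionality_dep => n.
apply: rnorm0_eq0; apply/eqP; rewrite eq_le rnorm_ge0 andbT.
apply: le_trans (rnorm_le_c0 x n) _.
by rewrite -(@ler_of_real R k) [of_real _ _]x0 of_real0.
Qed.

HB.instance Definition _ :=
  @Lmodule_isNormed.Build K c0_sum normK normKD normKZ normK0.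

Lemma rnorm_c0E x : rnorm x = c0_norm x.
Proof. exact: of_realK. Qed.

End c0_sum.

Definition finite_dim (K : fieldType) (V : lmodType K) : Prop :=
  exists d : nat, inhabited (Vector.axiom d V).

Definition dual (K : numFieldType) (X : normedModType K) : Type :=
  {f : {linear X -> K^o} | continuous f}.

(* The weak topology of X: the coarsest one making every element of the dual
   continuous. *)
Definition weak_topology_of (K : numFieldType) (X : normedModType K) :
    topologicalType :=
  sup_topology (fun f : dual X => Topological.on (initial_topology (sval f))).

Definition weakly_open (K : numFieldType) (X : normedModType K) (U : set X) :=
  @open (weak_topology_of X) U.

Definition unit_ball (K : numFieldType) (X : normedModType K) : set X :=
  [set x | `|x| <= 1].

Definition unit_sphere (K : numFieldType) (X : normedModType K) : set X :=
  [set x | `|x| = 1].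

Definition rel_weakly_open_ball (K : numFieldType) (X : normedModType K)
  (W : set X) : Prop := exists2 U, weakly_open U & W = U `&` @unit_ball K X.

(* The inner supremum is a maximum, the unit circle {theta | `|theta| = 1}
   of the scalar field being compact. *)
Definition super_AD_point (R : realType) (k : scalar_kind)
    (X : normedModType (scalars R k)) (x : X) : Prop :=
  unit_sphere x /\
  forall W : set X, rel_weakly_open_ball W ->
    W !=set0 -> W `&` @unit_sphere _ X !=set0 ->
    sup [set sup [set rnorm (x + theta *: y) |
                  theta in [set theta : scalars R k | `|theta| = 1]]
         | y in W] = 2.

(* Main.v *)
Require Import Defs.
From HB Require Import structures.
From mathcomp Require Import all_boot all_order all_algebra.
From mathcomp Require Import all_classical all_reals all_analysis.
From mathcomp Require Import lra.
From mathcomp.real_closed Require Import complex.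

(* On a finite-dimensional summand E_m the coordinate functionals are bounded,
   so the conditions |y_m - e| < eps define weak neighbourhoods in the whole
   sum. Such a neighbourhood W can be placed so that x and the points of W are
   almost disjointly supported.
   In the l_p-sum choose m with |x_m| small and a unit vector e in E_m. If y is
   in the unit ball with y_m close to e, then the rest of y is small, so
   x + theta y is nearly x' + theta y_m with x' vanishing at m, of norm at most
   2^(1/p) < 2.
   In the c_0-sum let |x_n| <= 1/2 for n >= N and ask that |y_n| < 1/2 for
   n < N: then |x + theta y| <= 3/2, and W contains unit vectors supported
   at N. *)

Set Implicit Arguments.
Unset Strict Implicit.
Unset Printing Implicit Defensive.

Import Order.TTheory GRing.Theory Num.Theory.
Import numFieldNormedType.Exports.

Local Open Scope classical_set_scope.
Local Open Scope ring_scope.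

(** * Real-valued norms and moduli, and completeness of the scalar field *)

Section real_modulus.
Variables (R : realType) (k : scalar_kind).
Local Notation K := (scalars R k).
Implicit Types a : K.

Lemma re_part_norm_ge0 a : 0 <= re_part `|a|.
Proof. by rewrite -(@ler_of_real R k) of_real0 re_partK. Qed.

Lemma re_part_norm0 : re_part `|0 : K| = 0 :> R.
Proof. by rewrite normr0; case: (k). Qed.

Lemma re_part_norm1 : re_part `|1 : K| = 1 :> R.
Proof. by rewrite normr1; case: (k). Qed.

Lemma rnormN (X : normedModType K) (x : X) : rnorm (- x) = rnorm x.
Proof. by rewrite /rnorm normrN. Qed.

Lemma rnorm_eq1 (X : normedModType K) (x : X) : (rnorm x = 1) <-> (`|x| = 1).
Proof.
have of1 : of_real k (1 : R) = 1 by case: (k).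
split=> [x1|x1]; first by rewrite -rnormE x1.
by rewrite /rnorm x1; case: (k).
Qed.

Lemma rnorm_le1 (X : normedModType K) (x : X) : (rnorm x <= 1) = (`|x| <= 1).
Proof.
have of1 : of_real k (1 : R) = 1 by case: (k).
by rewrite -(@ler_of_real R k) rnormE of1.
Qed.

Lemma rnormZ1 (X : normedModType K) a (x : X) :
  `|a| = 1 -> rnorm (a *: x) = rnorm x.
Proof. by move=> a1; rewrite rnormZ a1 -normr1 re_part_norm1 mul1r. Qed.

Lemma exists_unit_vector (X : normedModType K) :
  (exists v : X, v != 0) -> exists e : X, rnorm e = 1.
Proof.
move=> [v v0]; exists (`|v|^-1 *: v); apply/rnorm_eq1.
by rewrite normrZ normfV normr_id mulVf// normr_eq0.
Qed.

End real_modulus.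

(* The real limit is [sup (u n - e n)]: comparing [u n - e n] with [u m + e m]
   makes the estimate hold for every [n], whether or not [e] tends to [0]. *)
Lemma real_complete (R : realType) (u e : nat -> R) :
  (forall n m, `|u n - u m| <= e n + e m) ->
  exists l, forall n, `|u n - l| <= e n.
Proof.
move=> ue; pose A := range (fun n => u n - e n).
have ubA m : ubound A (u m + e m).
  by move=> _ [n _ <-]; have := ue n m; rewrite ler_norml => /andP[_]; lra.
have A0 : A !=set0 by exists (u 0%N - e 0%N), 0%N.
exists (sup A) => n; rewrite ler_norml; apply/andP; split.
  have : sup A <= u n + e n by apply: ge_sup => //; exact: ubA.
  by lra.
have : u n - e n <= sup A.
  by apply: ub_le_sup; [exists (u 0%N + e 0%N); exact: ubA | exists n].
by lra.
Qed.

Lemma normc_bounds (R : realType) (z : R[i]) (r : R) :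
  complex.Re `|z| <= r -> `|complex.Re z| <= r /\ `|complex.Im z| <= r.
Proof.
case: z => a b; rewrite /= => H.
have r0 : 0 <= r by apply: le_trans H; exact: sqrtr_ge0.
by split; (apply: le_trans H; rewrite -sqrtr_sqr ler_sqrt ?addr_ge0 ?sqr_ge0//;
  rewrite ?lerDl ?lerDr sqr_ge0).
Qed.

Lemma normc_le (R : realType) (z : R[i]) :
  complex.Re `|z| <= `|complex.Re z| + `|complex.Im z|.
Proof.
case: z => a b /=.
rewrite -[leRHS]ger0_norm ?addr_ge0// -sqrtr_sqr ler_sqrt ?sqr_ge0//.
rewrite -(real_normK (num_real a)) -(real_normK (num_real b)) sqrrD.
by rewrite -addrA lerD2l lerDr mulrn_wge0// mulr_ge0.
Qed.

(** For complex scalars [real_complete] applies to the real and imaginary parts separately; adding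
    the two estimates gives the factor 2. *)
Lemma scalars_complete (R : realType) (k : scalar_kind)
    (u : nat -> scalars R k) (e : nat -> R) :
  (forall n m, re_part `|u n - u m| <= e n + e m) ->
  exists l, forall n, re_part `|u n - l| <= 2 * e n.
Proof.
case: k u => /= [u ue|u ue].
  have [l ul] := real_complete ue; exists l => n.
  have := ul n; have := normr_ge0 (u n - l); lra.
have ReB (z w : R[i]) : complex.Re (z - w) = complex.Re z - complex.Re w.
  by case: z w => [? ?] [? ?].
have ImB (z w : R[i]) : complex.Im (z - w) = complex.Im z - complex.Im w.
  by case: z w => [? ?] [? ?].
have [a ua] : exists a, forall n, `|complex.Re (u n) - a| <= e n.
  by apply: real_complete => n m; rewrite -ReB; have [] := normc_bounds (ue n m).
have [b ub] : exists b, forall n, `|complex.Im (u n) - b| <= e n.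
  by apply: real_complete => n m; rewrite -ImB; have [] := normc_bounds (ue n m).
exists (a +i* b)%C => n; apply: le_trans (normc_le _) _.
by rewrite ReB ImB /= mulr_natl mulr2n lerD.
Qed.

(** * Bounded coordinates on finite-dimensional spaces *)

Section coordinates.
Variables (R : realType) (k : scalar_kind).
Local Notation K := (scalars R k).
Variable X : normedModType K.

Lemma ler_rnorm_sum d (F : 'I_d -> X) :
  rnorm (\sum_i F i) <= \sum_i rnorm (F i).
Proof.
elim/big_ind2 : _ => [|r x s y xr ys|//]; first by rewrite rnorm0.
by apply: le_trans (ler_rnormD x y) _; exact: lerD.
Qed.

(* If [b d] were at distance [0] from the span of the previous vectors, the
   coefficients of a sequence of approximants would be Cauchy, and their limits
   would express [b d] as a combination of the previous vectors. *)
Lemma coords_bounded d (b : nat -> X) :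
  (forall a : nat -> K, \sum_(i < d) a i *: b i = 0 ->
     forall i, (i < d)%N -> a i = 0) ->
  exists C : R, 0 <= C /\ forall a : nat -> K, forall i, (i < d)%N ->
    re_part `|a i| <= C * rnorm (\sum_(i < d) a i *: b i).
Proof.
elim: d => [|d ih] free; first by exists 0.
have [|C [C0 bC]] := ih.
  move=> a a0 i id; pose a' n := if (n < d)%N then a n else 0.
  have /free/(_ i (ltnW _)) : \sum_(i < d.+1) a' i *: b i = 0.
    rewrite big_ord_recr/= /a' ltnn scale0r addr0 -[RHS]a0.
    by apply: eq_bigr => j _; rewrite ltn_ord.
  by rewrite /a' id; apply; rewrite ltnS.
have [delta [delta0 dist]] : exists delta : R, 0 < delta /\
    forall a : nat -> K, delta <= rnorm (b d - \sum_(i < d) a i *: b i).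
  apply: contrapT => nodelta.
  have /choice[a ha] : forall n : nat, exists a : nat -> K,
      rnorm (b d - \sum_(i < d) a i *: b i) <= n.+1%:R^-1.
    move=> n; apply: contrapT => na; apply: nodelta; exists n.+1%:R^-1.
    split=> [|a]; first by rewrite invr_gt0.
    by rewrite leNgt; apply/negP => /ltW ?; apply: na; exists a.
  have /choice[l hl] : forall i, exists l : K, (i < d)%N ->
      forall n, re_part `|a n i - l| <= 2 * (C * n.+1%:R^-1).
    move=> i; have [id|] := boolP (i < d)%N; last by exists 0.
    have [|l hl] := @scalars_complete R k (fun n => a n i)
      (fun n => C * n.+1%:R^-1); last by exists l.
    move=> n m; have /= := bC (fun j => a n j - a m j) i id.
    move=> /le_trans; apply; rewrite -mulrDr ler_wpM2l//.
    have -> : \sum_(j < d) (a n j - a m j) *: b j =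
        - (b d - \sum_(j < d) a n j *: b j) + (b d - \sum_(j < d) a m j *: b j).
      rewrite opprB addrA subrK -sumrB.
      by apply: eq_bigr => j _; rewrite scalerBl.
    by rewrite (le_trans (ler_rnormD _ _))// rnormN lerD.
  (* The summand 1 pays for the approximant [a n], the sum for replacing its coefficients by their
     limits [l]. *)
  pose M := 1 + \sum_(i < d) 2 * C * rnorm (b i).
  have M1 : 1 <= M.
    by rewrite lerDl sumr_ge0// => i _; rewrite !mulr_ge0// rnorm_ge0.
  have le_M n : rnorm (b d - \sum_(i < d) l i *: b i) <= M / n.+1%:R.
    have -> : b d - \sum_(i < d) l i *: b i =
        (b d - \sum_(i < d) a n i *: b i) + \sum_(i < d) (a n i - l i) *: b i.
      under [X in _ = _ + X]eq_bigr do rewrite scalerBl.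
      by rewrite sumrB addrA subrK.
    rewrite (le_trans (ler_rnormD _ _))// mulrDl mul1r lerD//.
    rewrite (le_trans (ler_rnorm_sum _))//.
    rewrite mulr_suml; apply: ler_sum => i _; rewrite rnormZ.
    rewrite [leRHS]mulrAC -[X in _ <= X * _]mulrA ler_wpM2r ?rnorm_ge0//.
    exact: hl.
  have eq0 : b d - \sum_(i < d) l i *: b i = 0.
    apply: rnorm0_eq0; apply/eqP; rewrite eq_le rnorm_ge0 andbT leNgt.
    apply/negP => r0; set r := rnorm _ in r0 le_M.
    have [n nM] : exists n, M / r < n.+1%:R.
      by exists (Num.truncn (M / r)); exact: truncnS_gt.
    have := le_M n; rewrite ler_pdivlMr// leNgt => /negP; apply.
    by rewrite mulrC -ltr_pdivrMr.
  pose a' n := if (n < d)%N then - l n else 1.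
  have /free/(_ d (ltnSn _)) : \sum_(i < d.+1) a' i *: b i = 0.
    rewrite big_ord_recr/= /a' ltnn scale1r -[RHS]eq0 addrC -sumrN.
    by congr (_ + _); apply: eq_bigr => j _; rewrite ltn_ord scaleNr.
  by rewrite /a' ltnn => /eqP; rewrite oner_eq0.
(* Dividing the combination by [a d] leaves [b d] minus a combination of the previous vectors, whose
   norm is at least [delta]. *)
have last_le (a : nat -> K) :
    re_part `|a d| <= delta^-1 * rnorm (\sum_(i < d.+1) a i *: b i).
  have [->|ad0] := eqVneq (a d) 0.
    by rewrite re_part_norm0 mulr_ge0 ?rnorm_ge0// invr_ge0 (ltW delta0).
  rewrite ler_pdivlMl// mulrC.
  have -> : \sum_(i < d.+1) a i *: b i =
      a d *: (b d - \sum_(i < d) (- (a d)^-1 * a i) *: b i).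
    rewrite big_ord_recr/= scalerBr addrC; congr (_ + _).
    rewrite -scalerN -sumrN scaler_sumr; apply: eq_bigr => i _.
    by rewrite -scaleNr mulNr opprK scalerA mulrA divff// mul1r.
  rewrite rnormZ ler_wpM2l ?re_part_norm_ge0//.
  exact: (dist (fun i => - (a d)^-1 * a i)).
(* [delta^-1] serves the index [d]. For smaller indices [C] bounds the coefficient by the norm of
   [v - a d *: b d], which is at most [1 + delta^-1 * rnorm (b d)] times that of [v]. *)
exists (delta^-1 + C * (1 + delta^-1 * rnorm (b d))); split.
  by rewrite addr_ge0 ?mulr_ge0 ?addr_ge0 ?mulr_ge0 ?rnorm_ge0 ?invr_ge0 ?(ltW delta0).
move=> a i; set v := \sum_(i < d.+1) _.
rewrite ltnS leq_eqVlt => /orP[/eqP ->|id].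
  apply: le_trans (last_le a) _; rewrite ler_wpM2r ?rnorm_ge0// lerDl.
  by rewrite mulr_ge0 ?addr_ge0 ?mulr_ge0 ?rnorm_ge0 ?invr_ge0 ?(ltW delta0).
apply: le_trans (bC a i id) _.
have -> : \sum_(j < d) a j *: b j = v - a d *: b d.
  by rewrite /v big_ord_recr/= addrK.
rewrite mulrDl ler_wpDl//.
  by rewrite mulr_ge0 ?rnorm_ge0// invr_ge0 (ltW delta0).
rewrite -mulrA ler_wpM2l// (le_trans (ler_rnormD _ _))// rnormN rnormZ.
by rewrite mulrDl mul1r lerD2l mulrAC ler_wpM2r ?rnorm_ge0.
Qed.

(** The standard basis of row vectors is carried over by the linear isomorphism, and
    [coords_bounded] supplies the common bound [C]. *)
Lemma finite_dim_coordinates : finite_dim X ->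
  exists (d : nat) (b : 'I_d -> X) (c : 'I_d -> X -> K) (C : R),
    [/\ 0 <= C, forall i, linear (c i : X -> K^o),
      forall v, v = \sum_(i < d) c i v *: b i &
      forall i v, re_part `|c i v| <= C * rnorm v].
Proof.
move=> [d [[f flin [g fK gK]]]].
pose f' := HB.pack_for {linear X -> 'rV[K]_d} f (GRing.isLinear.Build _ _ _ _ f flin).
have glin : linear g by exact: (@can2_linear _ _ _ f' g fK gK).
pose g' := HB.pack_for {linear 'rV[K]_d -> X} g (GRing.isLinear.Build _ _ _ _ g glin).
have fK' : cancel f g' := fK.
have gK' : cancel g' f := gK.
pose b (i : 'I_d) := g' (delta_mx 0 i).
have gE v : g' v = \sum_(i < d) v 0 i *: b i.
  rewrite {1}[v]row_sum_delta linear_sum.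
  by apply: eq_bigr => i _; rewrite linearZ.
(* [coords_bounded] takes families indexed by [nat]; [insub] extends [b] by the default 0, and only
   indices below [d] enter the sums. *)
have [|C [C0 bC]] := @coords_bounded d (fun n => oapp b 0 (insub n)).
  move=> a a0 i id; pose v : 'rV[K]_d := \row_j a j.
  have /(can_inj gK')/rowP/(_ (Ordinal id)) : g' v = g' 0.
    rewrite linear0 gE -[RHS]a0; apply: eq_bigr => j _.
    by rewrite mxE valK.
  by rewrite !mxE.
exists d, b, (fun i v => f v 0 i), C; split=> //.
- by move=> i a u v; rewrite flin !mxE.
- by move=> v; rewrite -gE fK'.
move=> i v; pose a n := oapp (fun j => f v 0 j) 0 (insub n).
have := bC a i (ltn_ord i); rewrite {1}/a valK /= => /le_trans; apply.
rewrite -[in leRHS](fK' v) gE ler_wpM2l//.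
by under eq_bigr do rewrite /a valK.
Qed.

End coordinates.

(** * Weakly open sets and a criterion excluding super AD points *)

Section weak_topology.
Variables (K : numFieldType) (X : normedModType K).

Lemma weakly_open_bigcap (I : finType) (U : I -> set X) :
  (forall i, weakly_open (U i)) -> weakly_open (\bigcap_i U i).
Proof.
move=> Uopen; rewrite -bigsetI_fset_set; last exact: finite_finset.
elim/big_ind : _ => [|V W|i _]; last exact: Uopen.
- exact: openT.
- exact: openI.
Qed.

(** A sup topology refines each of its members, here the initial topology of [f], in which such a
    preimage is open by definition. *)
Lemma weakly_open_preimage (f : dual X) (A : set K^o) :
  open A -> weakly_open (sval f @^-1` A).
Proof.
move=> Aopen; rewrite /weakly_open openE => t At; rewrite /interior.
have /cvg_sup/(_ f) : nbhs (t : weak_topology_of X) --> (t : weak_topology_of X).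
  exact: cvg_id.
apply; apply: open_nbhs_nbhs; split=> //.
by exists A.
Qed.

End weak_topology.

Lemma bounded_linear_functional_continuous (R : realType) (k : scalar_kind)
    (X : normedModType (scalars R k)) (f : {linear X -> (scalars R k)^o}) (C : R) :
  (forall x, re_part `|f x| <= C * rnorm x) -> continuous f.
Proof.
move=> fC; apply/bounded_linear_continuous/linear_boundedP.
exists (of_real k C); split.
  by rewrite realE -(@of_real0 R k) !ler_of_real le_total.
move=> r Cr x; apply: le_trans (ler_wpM2r (normr_ge0 x) (ltW Cr)).
by rewrite -(re_partK (normr_ge0 (f x))) -(rnormE x) -of_realM ler_of_real fC.
Qed.


(** [U] asks each of the finitely many coordinates of [g x] to be close to that of [e]. They are
    continuous in [x], being bounded on [Y] while [g] does not increase norms. *)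
Lemma weak_nbhs_finite_dim (R : realType) (k : scalar_kind)
    (X Y : normedModType (scalars R k)) (g : {linear X -> Y}) (e : Y) (eps : R) :
  finite_dim Y -> (forall x, rnorm (g x) <= rnorm x) -> 0 < eps ->
  exists U : set X, [/\ weakly_open U, (forall x, g x = e -> U x) &
    forall x, U x -> rnorm (g x - e) < eps].
Proof.
move=> /finite_dim_coordinates[d [b [c [C [C0 clin vE cC]]]]] g_le eps0.
have fP i : exists f : dual X, forall x, sval f x = c i (g x).
  pose h : X -> (scalars R k)^o := c i \o g.
  have hlin : linear h by move=> a x y; rewrite /h /= linearP clin.
  pose h' := HB.pack_for {linear X -> (scalars R k)^o} h
    (GRing.isLinear.Build _ _ _ _ h hlin).
  have hcont : continuous h'.
    apply: (@bounded_linear_functional_continuous _ _ _ h' C) => x.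
    by apply: le_trans (cC i (g x)) _; rewrite ler_wpM2l.
  by exists (exist _ h' hcont).
have /choice[f fE] := fP.
(* With radius [eps / M] on each coordinate, the total error is at most [eps / M] times the sum of
   the norms of the [b i]; the summand 1 makes [M] positive and this product strictly below
   [eps]. *)
pose M := 1 + \sum_(i < d) rnorm (b i).
have M0 : 0 < M by rewrite ltr_pwDl// sumr_ge0// => i _; exact: rnorm_ge0.
pose A i : set (scalars R k)^o := ball (c i e) (of_real k (eps / M)).
exists (\bigcap_i (sval (f i) @^-1` A i)); split.
- apply: weakly_open_bigcap => i; apply: weakly_open_preimage.
  exact: ball_open.
- move=> x gx i _; rewrite /A /= fE gx; apply: ballxx.
  (* Positivity of the radius in [K] is reduced to the reals, as [!=] together with [<=]. *)
  by rewrite lt_neqAle -(@of_real0 R k) (can_eq (@of_realK R k)) ler_of_real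
    lt_eqF ?ltW ?divr_gt0.
move=> x Ux.
have cU i : re_part `|c i (g x - e)| <= eps / M.
  have cB : c i (g x - e) = c i (g x) - c i e.
    by rewrite -scaleN1r addrC clin scaleN1r addrC.
  have := Ux i I; rewrite /A /= fE -ball_normE /= distrC -cB => /ltW.
  by rewrite -[X in X <= _]re_partK// ler_of_real.
rewrite [g x - e]vE; apply: le_lt_trans (ler_rnorm_sum _) _.
have le_sum : \sum_(i < d) rnorm (c i (g x - e) *: b i) <=
    eps / M * \sum_(i < d) rnorm (b i).
  by rewrite mulr_sumr ler_sum// => i _; rewrite rnormZ ler_wpM2r ?rnorm_ge0.
apply: le_lt_trans le_sum _.
by rewrite mulrAC ltr_pdivrMr// ltr_pM2l// ltrDr.
Qed.

(** The trace of [U] on the unit ball meets the sphere at [z], and [rho] bounds every norm in the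
    two nested suprema, which therefore stay below 2. *)
Lemma not_super_AD_point (R : realType) (k : scalar_kind)
    (X : normedModType (scalars R k)) (x z : X) (U : set X) (rho : R) :
  weakly_open U -> U z -> rnorm z = 1 -> rho < 2 ->
  (forall y theta, U y -> rnorm y <= 1 -> `|theta| = 1 ->
     rnorm (x + theta *: y) <= rho) ->
  ~ super_AD_point x.
Proof.
move=> Uopen Uz z1 rho2 le_rho [_ AD].
have zW : (U `&` @unit_ball _ X) z by split=> //; rewrite /unit_ball/= -rnorm_le1 z1.
have : sup [set sup [set rnorm (x + theta *: y) |
    theta in [set theta : scalars R k | `|theta| = 1]]
    | y in U `&` @unit_ball _ X] <= rho.
  apply: ge_sup; first by eexists; exists z.
  move=> _ [y [Uy y1] <-]; move: y1; rewrite /unit_ball/= -rnorm_le1 => y1.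
  apply: ge_sup; first by exists (rnorm (x + 1 *: y)), 1 => //=; exact: normr1.
  by move=> _ [theta /= theta1 <-]; exact: le_rho.
rewrite AD; first by rewrite leNgt rho2.
- by exists U.
- by exists z.
- by exists z; split=> //; apply/rnorm_eq1.
Qed.

(** * Splitting a sequence into one coordinate and the rest *)

Section single.
Variables (R : realType) (k : scalar_kind).
Local Notation K := (scalars R k).
Variable E : nat -> normedModType K.
Local Notation S := (seq_space (fun n => E n : lmodType K)).

(** The summands have different types, so the value at [m] is inserted by the dependent update
    [dfwith], which handles the transport along [m = n]. *)
Definition single m (v : E m) : S := @dfwith _ (fun n => E n) (fun=> 0) m v.

Definition puncture m (y : S) : S := fun n => if n == m then 0 else y n.

Lemma single_in m (v : E m) : single v m = v.
Proof. exact: dfwithin. Qed.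

Lemma single_out m (v : E m) n : m != n -> single v n = 0.
Proof. exact: dfwithout. Qed.

Lemma puncture_in m y : puncture m y m = 0.
Proof. by rewrite /puncture eqxx. Qed.

Lemma puncture_out m y n : m != n -> puncture m y n = y n.
Proof. by rewrite /puncture eq_sym => /negbTE ->. Qed.

Lemma puncture_single m (v : E m) : puncture m (single v) = 0.
Proof.
apply: functional_extensionality_dep => n; rewrite /puncture.
by have [//|nm] := eqVneq n m; rewrite single_out// eq_sym.
Qed.

Lemma punctureD m (y z : S) : puncture m (y + z) = puncture m y + puncture m z.
Proof.
apply: functional_extensionality_dep => n; rewrite seq_spaceD /puncture.
by case: eqP; rewrite ?addr0.
Qed.

Lemma puncture_id m y : puncture m (puncture m y) = puncture m y.
Proof.
by apply: functional_extensionality_dep => n; rewrite /puncture; case: eqP.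
Qed.

End single.

(** * Norm estimates in the l_p-sum *)

Section lp_sum_estimates.
Variables (R : realType) (k : scalar_kind).
Local Notation K := (scalars R k).
Variable E : nat -> normedModType K.
Local Notation S := (seq_space (fun n => E n : lmodType K)).
Variables (p : R) (p1 : 1 <= p).

Let p0 : 0 < p. Proof. exact: lt_le_trans p1. Qed.

Local Open Scope ereal_scope.

(** The p-th power of the l_p-norm, possibly infinite. Unlike the norm, it is additive over disjoint
    supports. *)
Definition lp_mass (y : S) : \bar R := \sum_(n <oo) (rnorm (y n) `^ p)%:E.

Lemma lp_mass_ge0 y : 0 <= lp_mass y.
Proof. by apply: nneseries_ge0 => n _ _; rewrite lee_fin powR_ge0. Qed.

Lemma lp_mass_puncture m y :
  lp_mass y = (rnorm (y m) `^ p)%:E + lp_mass (puncture m y).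
Proof.
rewrite /lp_mass (@nneseriesD1 _ _ m)//; last first.
  by move=> n _; rewrite lee_fin powR_ge0.
congr (_ + _); rewrite eseries_mkcond; apply: eq_eseriesr => n _.
by rewrite /puncture; case: eqP => //= _; rewrite rnorm0 powR0 ?gt_eqF.
Qed.

Lemma lp_enorm_le (y : S) (r : R) :
  (0 <= r)%R -> (lp_enorm p y <= r%:E) = (lp_mass y <= (r `^ p)%:E).
Proof.
move=> r0; have := lp_mass_ge0 y; rewrite /lp_enorm -/(lp_mass y).
case: (lp_mass y) => [s|_|//].
  rewrite lee_fin => s0; rewrite poweR_EFin !lee_fin.
  apply/idP/idP => [sr|sr].
    have : ((s `^ p^-1) `^ p <= r `^ p)%R.
      by apply: ge0_ler_powR => //; rewrite ?nnegrE ?powR_ge0 ?(ltW p0).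
    by rewrite -powRrM mulVf ?gt_eqF// powRr1.
  have : (s `^ p^-1 <= (r `^ p) `^ p^-1)%R.
    by apply: ge0_ler_powR => //; rewrite ?nnegrE ?powR_ge0 ?invr_ge0 ?(ltW p0).
  by rewrite -powRrM divff ?gt_eqF// powRr1.
(* Infinite mass: both sides are false. *)
by rewrite poweRyr ?invr_neq0 ?gt_eqF ?leye_eq.
Qed.

Lemma lp_mass_single m (v : E m) : lp_mass (single v) = (rnorm v `^ p)%:E.
Proof.
rewrite (lp_mass_puncture m) single_in puncture_single.
rewrite [lp_mass _]eseries0 ?adde0// => n _ _.
by rewrite seq_space0 rnorm0 powR0 ?gt_eqF.
Qed.

Local Close Scope ereal_scope.

Lemma lp_norm_le (x : lp_sum E p1) (r : R) :
  0 <= r -> (rnorm x <= r) = (lp_mass x <= (r `^ p)%:E)%E.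
Proof. by move=> r0; rewrite rnorm_lpE -lee_fin lp_normE lp_enorm_le. Qed.

Lemma rnorm_coord_le_lp (x : lp_sum E p1) m : rnorm (x m) <= rnorm x.
Proof.
have := lexx (rnorm x); rewrite {1}lp_norm_le ?rnorm_ge0//.
rewrite (lp_mass_puncture m) => H.
have : ((rnorm (x m) `^ p)%:E <= (rnorm x `^ p)%:E)%E.
  by apply: le_trans H; rewrite leeDl// lp_mass_ge0.
rewrite lee_fin; apply: contraTT; rewrite -!ltNge => lt_x.
by rewrite gt0_ltr_powR ?nnegrE ?rnorm_ge0.
Qed.

(* At most [(rnorm x / eta) ^ p] coordinates can exceed [eta]. *)
Lemma lp_small_coord (x : lp_sum E p1) (eta : R) :
  0 < eta -> exists m, rnorm (x m) <= eta.
Proof.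
move=> eta0; apply: contrapT => /forallNP big.
have etap : 0 < eta `^ p by exact: powR_gt0.
pose N := (Num.truncn (rnorm x `^ p / eta `^ p)).+1.
have : rnorm x `^ p / eta `^ p < N%:R by exact: truncnS_gt.
rewrite ltr_pdivrMr// ltNge => /negP; apply; rewrite -lee_fin.
have := lexx (rnorm x); rewrite {1}lp_norm_le ?rnorm_ge0//; apply: le_trans.
apply: le_trans (nneseries_lim_ge N _); last first.
  by move=> n _; rewrite lee_fin powR_ge0.
rewrite sumEFin lee_fin big_mkord mulr_natl -[X in _ *+ X](card_ord N).
rewrite -sumr_const; apply: ler_sum => i _.
apply: ge0_ler_powR; rewrite ?nnegrE ?rnorm_ge0 ?(ltW p0) ?(ltW eta0)//.
by rewrite leNgt; apply/negP => /ltW; exact: big.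
Qed.

Lemma single_lp_subproof m (v : E m) : single v \in lp_pred p.
Proof.
apply/asboolP; apply: le_lt_trans (ltry (rnorm v)).
by rewrite lp_enorm_le ?rnorm_ge0// lp_mass_single.
Qed.

Definition single_lp m (v : E m) : lp_sum E p1 := LpSum p1 (single_lp_subproof v).

Lemma rnorm_single_lp m (v : E m) : rnorm (single_lp v) = rnorm v.
Proof.
apply/eqP; rewrite eq_le lp_norm_le ?rnorm_ge0// lp_mass_single lexx/=.
by have := rnorm_coord_le_lp (single_lp v) m; rewrite /= single_in.
Qed.

End lp_sum_estimates.

(** * Sequences supported at one index in the c_0-sum *)

Section c0_single.
Variables (R : realType) (k : scalar_kind).
Local Notation K := (scalars R k).
Variable E : nat -> normedModType K.

Lemma single_c0_subproof m (v : E m) : single v \in c0_pred (E := E).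
Proof.
apply/asboolP; apply: cvg_near_cst; exists m.+1 => // n /= mn.
by rewrite single_out ?rnorm0// neq_ltn mn.
Qed.

Definition single_c0 m (v : E m) : c0_sum E := C0Sum (single_c0_subproof v).

Lemma rnorm_single_c0 m (v : E m) : rnorm (single_c0 v) = rnorm v.
Proof.
rewrite rnorm_c0E; apply/eqP; rewrite eq_le; apply/andP; split.
  apply: c0_norm_le => n /=; have [<-|mn] := eqVneq m n.
    by rewrite single_in.
  by rewrite single_out// rnorm0 rnorm_ge0.
by have := rnorm_le_c0 (single_c0 v) m; rewrite /= single_in.
Qed.

End c0_single.

(** * Exclusion of super AD points in both sums *)

Section no_super_AD_points.
Variables (R : realType) (k : scalar_kind).
Local Notation K := (scalars R k).
Variable E : nat -> normedModType K.
Hypothesis Efin : forall n, finite_dim (E n).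
Hypothesis Enz : forall n, exists v : E n, v != 0.

Lemma lp_sum_no_super_AD_point (p : R) (p1 : 1 < p) (x : lp_sum E (ltW p1)) :
  ~ super_AD_point x.
Proof.
move=> AD; have [/rnorm_eq1 x1 _] := AD.
have p0 : 0 < p by exact: (lt_trans ltr01 p1).
have pV0 : 0 < p^-1 by rewrite invr_gt0.
have oneX r : 1 `^ r = 1 :> R by rewrite powR1.
(* [c] bounds the norm of a sum of two disjointly supported vectors of norm at most 1; it is below 2
   because [p > 1]. *)
pose c : R := 2 `^ p^-1.
have c0 : 0 < c by exact: powR_gt0.
have cp : c `^ p = 2 by rewrite -powRrM mulVf ?gt_eqF// powRr1.
have c2 : c < 2.
  by rewrite -ltr_ln ?posrE// ln_powR gtr_pMl ?ln_gt0 ?ltr1n// invf_lt1.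
(* [eta] will bound both [x] at [m] and the part of [y] off [m]; the final bound [c + (eta + eta)]
   is the midpoint of [c] and 2. *)
pose eta := (2 - c) / 4.
have eta0 : 0 < eta by rewrite divr_gt0// subr_gt0.
have eta1 : eta < 1 by rewrite /eta; lra.
have [m xm] := lp_small_coord x eta0.
have [e e1] := exists_unit_vector (Enz m).
(* For [y] in the unit ball, mass at least [t] at [m] leaves at most the p-th power of [eta]
   elsewhere. *)
pose t := 1 - eta `^ p.
have t1 : t < 1 by rewrite gtrBl powR_gt0.
have t0 : 0 <= t.
  rewrite subr_ge0 -(oneX p); apply: ge0_ler_powR; rewrite ?nnegrE ?ltW//.
(* With this radius around the unit vector [e], the triangle inequality forces mass at least [t] at
   [m]. *)
have eps0 : 0 < 1 - t `^ p^-1.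
  rewrite subr_gt0 -[ltRHS](oneX p^-1).
  by rewrite gt0_ltr_powR ?nnegrE.
pose g (y : lp_sum E (ltW p1)) : E m := y m.
have glin : linear g by [].
pose g' := HB.pack_for {linear lp_sum E (ltW p1) -> E m} g
  (GRing.isLinear.Build _ _ _ _ g glin).
have [U [Uopen Ue Ule]] := @weak_nbhs_finite_dim _ _ _ _ g' e _ (Efin m)
  (fun y => rnorm_coord_le_lp y m) eps0.
apply: (@not_super_AD_point _ _ _ x (single_lp (ltW p1) e) U (c + (eta + eta))) => //.
- by apply: Ue; rewrite /= /g /= single_in.
- by rewrite rnorm_single_lp.
- by rewrite /eta; lra.
move=> y theta Uy y1 theta1.
have ym : t <= rnorm (y m) `^ p.
  have -> : t = (t `^ p^-1) `^ p by rewrite -powRrM mulVf ?gt_eqF// powRr1.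
  apply: ge0_ler_powR; rewrite ?nnegrE ?powR_ge0 ?rnorm_ge0 ?(ltW p0)//.
  have := Ule y Uy; have := ler_rnormD (g' y) (- (g' y - e)).
  rewrite rnormN opprB addrC subrK e1 /= /g; lra.
have mass1 (w : lp_sum E (ltW p1)) : rnorm w <= 1 -> (lp_mass p w <= 1)%E.
  by rewrite lp_norm_le// powR1.
have xE : (lp_mass p (puncture m x) <= 1)%E.
  apply: le_trans (mass1 x _); last by rewrite x1.
  by rewrite (lp_mass_puncture (ltW p1) m x) leeDr// lee_fin powR_ge0.
have yE : (lp_mass p (puncture m y) <= (eta `^ p)%:E)%E.
  have := mass1 y y1; rewrite (lp_mass_puncture (ltW p1) m y) -leeBrDl//.
  move=> /le_trans; apply; rewrite -EFinB lee_fin; move: ym; rewrite /t; lra.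
have ym1 : rnorm (y m) <= 1 by apply: le_trans y1; exact: rnorm_coord_le_lp.
rewrite rnorm_lpE -lee_fin lp_normE.
(* [u] collects the large pieces, [y] at [m] and [x] off [m]; [v] collects the two small ones, each
   of norm at most [eta]. *)
pose u : seq_space (fun n => E n : lmodType K) :=
  single (theta *: y m) + puncture m x.
pose v : seq_space (fun n => E n : lmodType K) :=
  single (x m) + theta *: puncture m y.
have -> : lp_seq (x + theta *: y) = u + v.
  apply: functional_extensionality_dep => n.
  rewrite /u /v !seq_spaceD seq_spaceZ.
  have [<-|mn] := eqVneq m n.
    by rewrite !single_in !puncture_in scaler0 !addr0 addrC.
  by rewrite !single_out// !puncture_out// !add0r.
rewrite (le_trans (lp_enormD (ltW p1) _ _))// EFinD leeD//.
  (* The two pieces of [u] have mass at most 1 each, and 2 is the p-th power of [c]. *)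
  rewrite lp_enorm_le ?(ltW c0)// ?(ltW p1)// (lp_mass_puncture (ltW p1) m).
  rewrite /u punctureD puncture_single add0r puncture_id seq_spaceD single_in.
  rewrite puncture_in addr0 rnormZ1// cp -[2]/(1 + 1) EFinD leeD// lee_fin.
  apply: le_trans (ge0_ler_powR (ltW p0) _ _ ym1) _;
    by rewrite ?nnegrE ?rnorm_ge0 ?oneX.
rewrite (le_trans (lp_enormD (ltW p1) _ _))// EFinD leeD//.
  rewrite lp_enorm_le ?(ltW p1) ?(ltW eta0)// lp_mass_single ?(ltW p1)//.
  by rewrite lee_fin ge0_ler_powR ?nnegrE ?rnorm_ge0 ?(ltW eta0) ?(ltW p0).
rewrite lp_enormZ ?(ltW p1)// theta1 -[X in re_part X]normr1 re_part_norm1 mul1e.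
by rewrite lp_enorm_le ?(ltW p1) ?(ltW eta0).
Qed.

Lemma c0_sum_no_super_AD_point (x : c0_sum E) : ~ super_AD_point x.
Proof.
move=> AD; have [/rnorm_eq1 x1 _] := AD.
have /asboolP/cvgrPdist_le/(_ (1 / 2)) := valP x.
rewrite divr_gt0// => /(_ isT) [N _ xN].
have [e e1] := exists_unit_vector (Enz N).
have half0 : 0 < 1 / 2 :> R by lra.
(* Weak neighbourhoods of 0 pulled back from the summands below [N]; being finitely many, they have
   a weakly open intersection. *)
have /choice[U UP] (n : 'I_N) : exists U : set (c0_sum E), [/\
    weakly_open U, (forall y : c0_sum E, y n = 0 -> U y) &
    forall y : c0_sum E, U y -> rnorm (y n) < 1 / 2].
  pose g (y : c0_sum E) : E n := y n.
  have glin : linear g by [].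
  pose g' := HB.pack_for {linear c0_sum E -> E n} g
    (GRing.isLinear.Build _ _ _ _ g glin).
  have g_le y : rnorm (g' y) <= rnorm y by rewrite rnorm_c0E; exact: rnorm_le_c0.
  have [U [Uopen U0 Ule]] := weak_nbhs_finite_dim 0 (Efin n) g_le half0.
  by exists U; split=> // y Uy; have := Ule y Uy; rewrite subr0.
(* The vector [e] placed at index [N] vanishes below [N], so it lies in every [U n]. *)
apply: (@not_super_AD_point _ _ _ x (single_c0 e) (\bigcap_n U n) (3 / 2)) => //.
- by apply: weakly_open_bigcap => n; have [] := UP n.
- move=> n _; have [_ + _] := UP n; apply; rewrite /= single_out//.
  by rewrite neq_ltn ltn_ord orbT.
- by rewrite rnorm_single_c0.
- by lra.
move=> y theta Uy y1 theta1.
rewrite rnorm_c0E; apply: c0_norm_le => n.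
apply: le_trans (ler_rnormD _ _) _; rewrite rnormZ1//.
have xn : rnorm (x n) <= 1 by rewrite -x1 rnorm_c0E rnorm_le_c0.
have yn : rnorm (y n) <= 1 by apply: le_trans y1; rewrite rnorm_c0E rnorm_le_c0.
(* From [N] on, [x] contributes at most 1/2 and [y] at most 1; below [N] the roles are exchanged. *)
have [Nn|nN] := leqP N n.
  have := xN n Nn; rewrite sub0r normrN ger0_norm ?rnorm_ge0//; lra.
have [_ _ /(_ y (Uy (Ordinal nN) I))] := UP (Ordinal nN); lra.
Qed.

End no_super_AD_points.

Theorem corollary4p20 (R : realType) (k : scalar_kind)
    (E : nat -> completeNormedModType (scalars R k))
    (Efin : forall n, finite_dim (E n))
    (Enz : forall n, exists v : E n, v != 0)
    (p : R) (p1 : 1 < p) :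
  (forall x : lp_sum E (ltW p1), ~ super_AD_point x) /\
  (forall x : c0_sum E, ~ super_AD_point x).
Proof.
split=> x; first exact: lp_sum_no_super_AD_point.
exact: c0_sum_no_super_AD_point.
Qed.
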